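(* Let $a$ be a real number with $a\ne 0$ and let $n$ be a positive integer. Then $$\sum_{k=1}^n\binom{2n}{2k}2^{2k}E_{2n-2k,a}=\frac 2a+\frac{2-4a}{a^2}E_{2n,a},$$ and consequently, if moreover $a\ne \frac12$, $$E_{2n,a}=\frac{a}{2a-1}-\frac{a^2n}{2(2a-1)}\sum_{k=1}^n\binom{2n-1}{2k-1}\frac{4^k}{k}E_{2n-2k,a}.$$
   Context: For a real number $a$, the sequence $\{E_{n,a}\}$ is defined by $E_{0,a}=1$ and $E_{n,a}=-a\sum_{k=1}^{\lfloor n/2\rfloor}\binom{n}{2k}E_{n-2k,a}$ for $n\ge 1$. *)

(* Defs.v *)
From mathcomp Require Import all_boot all_order all_algebra.
From mathcomp Require Import reals.

Set Implicit Arguments.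
Unset Strict Implicit.
Unset Printing Implicit Defensive.

Import Order.TTheory GRing.Theory Num.Theory.

Local Open Scope ring_scope.

(* The recursion is on the fuel [m], of which [m = n] is enough since
   [n - 2 * k < n]; lemmas [Eseq0] and [Eseq_rec] below give the two equations
   that determine the sequence. *)
Fixpoint Eseq_fuel (R : realType) (a : R) (m n : nat) : R :=
  match m, n with
  | m'.+1, _.+1 =>
      - a * \sum_(1 <= k < (n./2).+1)
              'C(n, 2 * k)%:R * Eseq_fuel a m' (n - 2 * k)
  | _, _ => 1
  end.

Definition Eseq (R : realType) (n : nat) (a : R) : R := Eseq_fuel a n n.

Lemma Eseq_fuelE (R : realType) (a : R) (m n : nat) :
  (n <= m)%N -> Eseq_fuel a m n = Eseq n a.
Proof.
elim/ltn_ind: n m => -[|n] IH [|m] // lenm.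
rewrite /Eseq /=; congr (_ * _); apply: eq_big_nat => k /andP[k1 _].
have lek : (n.+1 - 2 * k <= n)%N.
  by rewrite leq_subLR -addn1 addnC leq_add2r muln_gt0.
by rewrite !IH // (leq_trans lek).
Qed.

Lemma Eseq0 (R : realType) (a : R) : Eseq 0 a = 1.
Proof. by []. Qed.

Lemma Eseq_rec (R : realType) (a : R) (n : nat) : (1 <= n)%N ->
  Eseq n a =
    - a * \sum_(1 <= k < (n./2).+1) 'C(n, 2 * k)%:R * Eseq (n - 2 * k) a.
Proof.
case: n => // n _; rewrite {1}/Eseq /=; congr (_ * _).
apply: eq_big_nat => k /andP[k1 _]; rewrite Eseq_fuelE //.
by rewrite leq_subLR -addn1 addnC leq_add2r muln_gt0.
Qed.

(* Main.v *)
(** With c = cosh t - 1, the exponential generating function E of the sequence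
    satisfies E (1 + a c) = 1, hence E c = (1 - E) / a and
    E c^2 = (c - E c) / a.  Since cosh 2t - 1 = 2 c^2 + 4 c, comparing the
    coefficients of t^(2n) in E (cosh 2t - 1) = 2 E c^2 + 4 E c gives the first
    identity; the second is a rearrangement of it, by
    'C(2n, 2k) = (n / k) 'C(2n-1, 2k-1).  Only even powers of t occur, so a
    series is encoded by its sequence of coefficients in t^2. *)

Require Import Defs.
From mathcomp Require Import all_boot all_order all_algebra.
From mathcomp Require Import reals.
From mathcomp Require Import ring.

Set Implicit Arguments.
Unset Strict Implicit.
Unset Printing Implicit Defensive.

Import Order.TTheory GRing.Theory Num.Theory.

Local Open Scope ring_scope.

Definition conv (R : pzSemiRingType) (u v : nat -> R) (n : nat) : R :=
  \sum_(i < n.+1) u i * v (n - i)%N.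

Lemma conv_coefM (R : nzSemiRingType) (u v : nat -> R) (m n : nat) : (n < m)%N ->
  ((\poly_(i < m) u i) * (\poly_(i < m) v i))`_n = conv u v n.
Proof.
move=> ltnm; rewrite coefM; apply: eq_bigr => i _.
by rewrite !coef_poly !(leq_ltn_trans _ ltnm) ?leq_subr // -ltnS.
Qed.

(** Coefficients up to [n] depend only on the series truncated after degree [n], so this is
    associativity of the product of polynomials. *)
Lemma convA (R : nzSemiRingType) (u v w : nat -> R) (n : nat) :
  conv u (conv v w) n = conv (conv u v) w n.
Proof.
pose p (z : nat -> R) := \poly_(i < n.+1) z i.
transitivity (p u * (p v * p w))`_n.
  rewrite coefM; apply: eq_bigr => i _.
  by rewrite conv_coefM ?ltnS ?leq_subr // coef_poly ltn_ord.
rewrite mulrA coefM; apply: eq_bigr => i _.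
by rewrite conv_coefM // coef_poly ltnS leq_subr.
Qed.

(** By Pascal's rule each even-indexed entry of row 2m+2 is the sum of two neighbours in row 2m+1,
    so the sum is that of the whole row 2m+1. *)
Lemma sum_bin_even (m : nat) :
  (\sum_(i < m.+2) 'C(2 * m.+1, 2 * i) = 2 ^ (2 * m).+1)%N.
Proof.
have pairs (F : nat -> nat) k :
    (\sum_(i < 2 * k) F i = \sum_(i < k) (F (2 * i) + F (2 * i).+1))%N.
  elim: k => [|k IH]; first by rewrite muln0 !big_ord0.
  by rewrite mulnS !big_ord_recr /= IH addnA.
have := expnDn 1 1 (2 * m).+1; rewrite addn1 => ->.
under [RHS]eq_bigr => i _ do rewrite !exp1n !muln1.
(* The zero entry of index 2m+2 is appended: once index 0 is split off, 2(m+1) terms remain and can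
   be paired. *)
transitivity (\sum_(i < (2 * m).+3) 'C((2 * m).+1, i))%N; last first.
  by rewrite big_ord_recr /= bin_small // addn0.
rewrite big_ord_recl [RHS]big_ord_recl !bin0; congr (_ + _)%N.
rewrite -[(2 * m).+2]addn2 addnC -mulnS.
rewrite [RHS](pairs (fun i => 'C((2 * m).+1, i.+1))).
apply: eq_bigr => i _.
by rewrite /= /bump /= add1n !mulnS !add2n binS addnC.
Qed.

Section GeneratingFunctions.

Variables (R : realType) (a : R).
Hypothesis a_neq0 : a != 0.

Definition invfact2 (i : nat) : R := (2 * i)`!%:R^-1.
Definition coshm1 (i : nat) : R := if i is 0 then 0 else invfact2 i.
Definition cosh2m1 (i : nat) : R := if i is 0 then 0 else 2 ^+ (2 * i) * invfact2 i.
Definition Egf (i : nat) : R := Eseq (2 * i) a * invfact2 i.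

Lemma invfact2_neq0 n : invfact2 n != 0.
Proof. by rewrite invr_eq0 pnatr_eq0 -lt0n fact_gt0. Qed.

Lemma invfact2M n i : (i <= n)%N ->
  invfact2 i * invfact2 (n - i) = 'C(2 * n, 2 * i)%:R * invfact2 n.
Proof.
move=> lein; rewrite /invfact2 -(@bin_fact (2 * n) (2 * i)) ?leq_mul2l // -mulnBr.
have f_neq0 m : m`!%:R != 0 :> R by rewrite pnatr_eq0 -lt0n fact_gt0.
have b_neq0 : 'C(2 * n, 2 * i)%:R != 0 :> R.
  by rewrite pnatr_eq0 -lt0n bin_gt0 leq_mul2l.
by rewrite !natrM; field; rewrite !f_neq0 b_neq0.
Qed.

(** This is cosh 2t - 1 = 2 c^2 + 4 c, solved for c^2. *)
Lemma conv_coshm1 n : conv coshm1 coshm1 n = cosh2m1 n / 2 - 2 * coshm1 n.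
Proof.
case: n => [|m]; first by rewrite /conv big_ord1 /=; ring.
rewrite /conv big_ord_recl big_ord_recr /= subnn !mul0r mulr0 add0r addr0.
have -> : \sum_(i < m) coshm1 (bump 0 i) * coshm1 (m.+1 - bump 0 i)
   = (\sum_(i < m) 'C(2 * m.+1, 2 * i.+1)%:R) * invfact2 m.+1.
  rewrite mulr_suml; apply: eq_bigr => i _.
  rewrite /bump /= add1n -invfact2M ?ltnS 1?ltnW //.
  (* Since i < m, the index m - i is a successor, where [coshm1] agrees with [invfact2]. *)
  by rewrite subSS -[(m - i)%N]prednK ?subn_gt0.
have := congr1 (fun k => k%:R : R) (sum_bin_even m).
rewrite big_ord_recl big_ord_recr /= muln0 bin0 /bump /= add1n binn.
under eq_bigr => i _ do rewrite add1n.
rewrite -add1n !natrD natr_sum natrX => sumE.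
have -> : \sum_(i < m) 'C(2 * m.+1, 2 * i.+1)%:R = 2 ^+ (2 * m).+1 - 2 :> R.
  by rewrite -sumE; ring.
by rewrite mulnS !exprS; field.
Qed.

(** Used with v = 1 for c and with v k = 2^(2k) for cosh 2t - 1; the vanishing constant term makes
    the sum start at k = 1. *)
Lemma conv_Egf (u : nat -> R) (v : nat -> R) n :
    u 0 = 0 -> (forall i, (0 < i)%N -> u i = v i * invfact2 i) ->
  conv Egf u n =
    (\sum_(1 <= k < n.+1) 'C(2 * n, 2 * k)%:R * v k * Eseq (2 * n - 2 * k) a)
      * invfact2 n.
Proof.
move=> u0 uE; rewrite big_add1 /= big_mkord mulr_suml /conv.
rewrite (reindex_inj rev_ord_inj) /= big_ord_recl /= !subSS subn0 subnn u0.
rewrite mulr0 add0r; apply: eq_bigr => i _.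
rewrite /bump /= add1n !subSS subKn // uE // /Egf -mulnBr.
transitivity (v i.+1 * Eseq (2 * (n - i.+1)) a
    * (invfact2 i.+1 * invfact2 (n - i.+1))).
  by ring.
by rewrite invfact2M //; ring.
Qed.

(** This is E c = (1 - E) / a: for n > 0 the recurrence of [Eseq], for n = 0 its initial value. *)
Lemma conv_Egf_coshm1 n :
  conv Egf coshm1 n = ((n == 0)%:R - Egf n) / a.
Proof.
rewrite (@conv_Egf _ (fun=> 1)) //; last by case=> // i _; rewrite mul1r.
case: n => [|n];
  first by rewrite big_geq // eqxx /Egf /invfact2 Eseq0 fact0 invr1 !mulr1
    subrr !mul0r.
rewrite /Egf [in RHS]Eseq_rec ?mulnS // -mulnS mul2n doubleK.
under eq_bigr => i _ do rewrite mulr1.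
by rewrite /= -mul2n; field.
Qed.

Lemma sum_Eseq n : (0 < n)%N ->
  \sum_(1 <= k < n.+1) 'C(2 * n, 2 * k)%:R * 2 ^+ (2 * k) * Eseq (2 * n - 2 * k) a
    = 2 / a + (2 - 4 * a) / a ^+ 2 * Eseq (2 * n) a.
Proof.
move=> n_gt0; apply: (mulIf (invfact2_neq0 n)).
rewrite -(@conv_Egf cosh2m1); [| by [] | by case].
(* E c^2 is computed in two ways: from the formula for c^2, then as (E c) c. *)
have Ecc : conv Egf (conv coshm1 coshm1) n
    = conv Egf cosh2m1 n / 2 - 2 * conv Egf coshm1 n.
  rewrite /conv mulr_suml mulr_sumr -sumrB; apply: eq_bigr => i _.
  by rewrite -/(conv _ _ _) conv_coshm1; ring.
have Ecc' : conv Egf (conv coshm1 coshm1) n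
    = (coshm1 n - conv Egf coshm1 n) / a.
  rewrite convA /conv; under eq_bigr => i _ do
    rewrite -/(conv _ _ _) conv_Egf_coshm1 mulrAC mulrBl mulrBl.
  rewrite sumrB -!mulr_suml -mulrBl; congr ((_ - _) / a).
  rewrite big_ord_recl subn0 mul1r big1 ?addr0 // => i _.
  by rewrite mul0r.
have -> : conv Egf cosh2m1 n = 2 * conv Egf (conv coshm1 coshm1) n
    + 4 * conv Egf coshm1 n by rewrite Ecc; field.
rewrite Ecc' conv_Egf_coshm1 (gtn_eqF n_gt0) /Egf.
(* Positivity of n is needed here: at 0 the two sides are 0 and 1. *)
have -> : coshm1 n = invfact2 n by case: n n_gt0 {Ecc Ecc'}.
by rewrite mulr0n; field.
Qed.

End GeneratingFunctions.

Theorem theorem2p3 (R : realType) (a : R) (n : nat) :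
  a != 0 -> (0 < n)%N ->
  \sum_(1 <= k < n.+1) 'C(2 * n, 2 * k)%:R * 2 ^+ (2 * k) * Eseq (2 * n - 2 * k) a
    = 2 / a + (2 - 4 * a) / a ^+ 2 * Eseq (2 * n) a
  /\
  (a != 1 / 2 ->
   Eseq (2 * n) a
    = a / (2 * a - 1)
      - a ^+ 2 * n%:R / (2 * (2 * a - 1))
        * \sum_(1 <= k < n.+1)
            'C(2 * n - 1, 2 * k - 1)%:R * (4 ^+ k / k%:R) * Eseq (2 * n - 2 * k) a).
Proof.
move=> a_neq0 n_gt0; have sumE := sum_Eseq a_neq0 n_gt0.
split=> // a_neq2.
have two_neq0 : 2 != 0 :> R by rewrite pnatr_eq0.
have a2_neq0 : 2 * a - 1 != 0.
  apply: contraNneq a_neq2 => /eqP; rewrite subr_eq0 => /eqP a2.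
  by apply/eqP/(mulfI two_neq0); rewrite a2; field.
have {}sumE : n%:R * \sum_(1 <= k < n.+1)
    'C(2 * n - 1, 2 * k - 1)%:R * (4 ^+ k / k%:R) * Eseq (2 * n - 2 * k) a
    = 2 / a + (2 - 4 * a) / a ^+ 2 * Eseq (2 * n) a.
  rewrite -sumE mulr_sumr; apply: eq_big_nat => -[|k] // /andP[_ _].
  have k_neq0 : k.+1%:R != 0 :> R by rewrite pnatr_eq0.
  (* Absorption: 2n 'C(2n-1, 2k+1) = (2k+2) 'C(2n, 2k+2), with [k] already shifted by one. *)
  have := congr1 (fun j => j%:R : R) (mul_bin_diag (2 * n) (2 * k).+1).
  rewrite -subn1 -[(2 * k).+2]/(2 + 2 * k)%N -mulnS !natrM => binE.
  have {}binE : 'C(2 * n, 2 * k.+1)%:R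
      = n%:R * 'C(2 * n - 1, 2 * k.+1 - 1)%:R / k.+1%:R :> R.
    apply: (canRL (mulfK k_neq0)); apply: (mulfI two_neq0).
    have -> : (2 * k.+1 - 1 = (2 * k).+1)%N by rewrite mulnS.
    by rewrite [_ * k.+1%:R]mulrC !mulrA.
  have -> : 4 = 2 ^+ 2 :> R by ring.
  by rewrite -exprM binE; ring.
(* The first identity is solved for [Eseq (2 * n) a]: the constants cancel and its coefficient
   becomes 1. *)
transitivity (a / (2 * a - 1) - a ^+ 2 / (2 * (2 * a - 1))
    * (2 / a + (2 - 4 * a) / a ^+ 2 * Eseq (2 * n) a)); last first.
  by rewrite -sumE; ring.
by field; rewrite a_neq0.
Qed.
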